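(* Let $n,q$ be positive integers with $q<n$, let $A\in\mathbb{R}^{n\times n}$ and $B\in\mathbb{R}^{n\times q}$. Assume that all eigenvalues of $A$ lie in the open left half plane $\mathbb{C}^-$ and that the field of values $W(A)$ has nonempty intersection with the open right half plane. Then the matrix $A+A^T$ is negative definite on the kernel of $B^T$ if and only if there exists a matrix $K\in\mathbb{R}^{q\times n}$ such that $W(A-BK)\subset\mathbb{C}^-$.
   Context: For $M\in\mathbb{R}^{n\times n}$, the field of values is $W(M)=\{x^*Mx : x\in\mathbb{C}^n,\ \|x\|=1\}$, where $\|\cdot\|$ is the Euclidean norm and $x^*$ the conjugate transpose. $\mathbb{C}^-$ denotes the open left half complex plane. ''Negative definite on the kernel of $B^T$'' means $x^T(A+A^T)x<0$ for every nonzero $x\in\mathbb{R}^n$ with $B^Tx=0$. *)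

(* Defs.v *)
From HB Require Import structures.
From mathcomp Require Import all_boot all_order all_algebra.
From mathcomp Require Import complex.
From mathcomp Require Import boolp classical_sets reals.
Set Implicit Arguments.
Unset Strict Implicit.
Unset Printing Implicit Defensive.
Import Order.TTheory GRing.Theory Num.Theory.
Local Open Scope classical_set_scope.
Local Open Scope sesquilinear_scope.
Local Open Scope ring_scope.

(* On [R[i]] the relation [z < 0] forces [z] to be real, so the half planes are
   stated on the [R]-valued real part. *)
Definition open_left_half_plane (R : realType) : set R[i] :=
  [set z | complex.Re z < 0].

Definition open_right_half_plane (R : realType) : set R[i] :=
  [set z | 0 < complex.Re z].

Arguments open_left_half_plane : clear implicits.
Arguments open_right_half_plane : clear implicits.

Definition complexify (R : realType) (m n : nat) (M : 'M[R]_(m, n)) :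
    'M[R[i]]_(m, n) :=
  map_mx (real_complex R) M.

Definition euclidean_norm (R : realType) (n : nat) (x : 'cV[R[i]]_n) : R[i] :=
  sqrtC (\sum_i `|x i 0| ^+ 2).

Definition field_of_values (R : realType) (n : nat) (M : 'M[R]_n) : set R[i] :=
  [set z | exists2 x : 'cV[R[i]]_n,
     euclidean_norm x = 1 & z = (x ^t* *m complexify M *m x) 0 0].

(* [eigenvalue] is defined with row eigenvectors; the spectrum is the same as
   with column eigenvectors. *)
Definition spectrum (R : realType) (n : nat) (M : 'M[R]_n) : set R[i] :=
  [set z | eigenvalue (complexify M) z].

Definition negative_definite_on_kernel (R : realType) (n m : nat)
    (S : 'M[R]_n) (C : 'M[R]_(m, n)) : Prop :=
  forall x : 'cV[R]_n, C *m x = 0 -> x != 0 -> (x^T *m S *m x) 0 0 < 0.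

(* Main.v *)
Require Import Defs.
From HB Require Import structures.
From mathcomp Require Import all_boot all_order all_algebra.
From mathcomp Require Import complex.
From mathcomp Require Import boolp classical_sets reals.
From mathcomp Require Import ring lra.
Import Order.TTheory GRing.Theory Num.Theory.
Local Open Scope classical_set_scope.
Local Open Scope ring_scope.

(** Write [x = a + i b] with [a], [b] real.  For a real matrix [M] the real part
of [x^* M x] is [a^T M a + b^T M b], so [W(M)] lies in the open left half plane
exactly when the real quadratic form of [M], equivalently that of its symmetric
part, is negative definite ([field_of_values_left_half_planeP]).

If [W(A - B K)] lies in the left half plane, then for a nonzero [x] in the kernel
of [B^T] the term [x^T B K x] vanishes, and what remains is
[x^T (A + A^T) x = 2 x^T (A - B K) x < 0].

The converse is Finsler's lemma ([finsler]): a symmetric [S] that is negative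
definite on the kernel of [C] becomes negative definite everywhere after
subtracting a large multiple [t C^T C].  With [S = A + A^T] and [C = B^T] the
feedback [K = (t / 2) B^T] then works, since the symmetric part of [A - B K] is
half of [S - t B B^T].  Finsler's lemma is linear algebra: being definite on
the kernel, [S] is nondegenerate there, so every vector splits [S]-orthogonally
into a kernel component, on which [S] is negative, and a remainder that depends
linearly on [y = C x] ([kernel_projection]).  On the remainder [S] is at most a
constant times [y^T y], which the term [- t y^T y] absorbs. *)

(** * Real quadratic forms *)

Section QuadraticForms.
Context {F : realFieldType}.

Definition qform {n} (M : 'M[F]_n) (x : 'cV[F]_n) : F := (x^T *m M *m x) 0 0.

Lemma qform_sumE {n} (M : 'M[F]_n) x :
  qform M x = \sum_i \sum_j x i 0 * M i j * x j 0.
Proof.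
rewrite /qform mxE exchange_big; apply: eq_bigr => j _.
by rewrite mxE mulr_suml; apply: eq_bigr => i _; rewrite mxE.
Qed.

Lemma qform_tr {n} (M : 'M[F]_n) x : qform M^T x = qform M x.
Proof.
have -> : qform M x = ((x^T *m M *m x)^T) 0 0 by rewrite [RHS]mxE.
by rewrite !trmx_mul trmxK mulmxA.
Qed.

Lemma qformD {n} (M N : 'M[F]_n) x : qform (M + N) x = qform M x + qform N x.
Proof. by rewrite /qform mulmxDr mulmxDl mxE. Qed.

Lemma qformB {n} (M N : 'M[F]_n) x : qform (M - N) x = qform M x - qform N x.
Proof. by rewrite /qform mulmxBr mulmxBl !mxE. Qed.

Lemma qformZ {n} c (M : 'M[F]_n) x : qform (c *: M) x = c * qform M x.
Proof. by rewrite /qform -scalemxAr -scalemxAl mxE. Qed.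

Lemma qform_scale {n} c (M : 'M[F]_n) x : qform M (c *: x) = c ^+ 2 * qform M x.
Proof.
by rewrite /qform -scalemxAr linearZ /= -!scalemxAl scalerA mxE expr2.
Qed.

Lemma qform0 {n} (M : 'M[F]_n) : qform M 0 = 0.
Proof. by rewrite /qform mulmx0 mxE. Qed.

Lemma qform_congr {n m} (P : 'M[F]_(n, m)) (M : 'M[F]_n) x :
  qform (P^T *m M *m P) x = qform M (P *m x).
Proof. by rewrite /qform trmx_mul !mulmxA. Qed.

Lemma qform_orthoD {n} {S : 'M[F]_n} {v w} :
  S^T = S -> v^T *m S *m w = 0 -> qform S (v + w) = qform S v + qform S w.
Proof.
move=> sS vw0.
have wv0 : w^T *m S *m v = 0.
  by apply: trmx_inj; rewrite !trmx_mul trmxK sS mulmxA vw0 trmx0.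
rewrite /qform mulmxDr linearD /= !mulmxDl vw0 wv0 addr0 add0r.
by rewrite mxE.
Qed.

Lemma qform1E {n} (x : 'cV[F]_n) : qform 1%:M x = \sum_i x i 0 ^+ 2.
Proof.
by rewrite /qform mulmx1 mxE; apply: eq_bigr => i _; rewrite mxE expr2.
Qed.

Lemma qform1_ge0 {n} (x : 'cV[F]_n) : 0 <= qform 1%:M x.
Proof. by rewrite qform1E sumr_ge0 // => i _; rewrite sqr_ge0. Qed.

Lemma qform1_eq0 {n} (x : 'cV[F]_n) : (qform 1%:M x == 0) = (x == 0).
Proof.
apply/eqP/eqP => [|->]; last exact: qform0.
move=> /eqP; rewrite qform1E psumr_eq0 => [/allP h|i _]; last exact: sqr_ge0.
apply/colP => i; rewrite mxE; apply/eqP.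
by rewrite -sqrf_eq0; apply: h; rewrite mem_index_enum.
Qed.

(** Any finite bound serves below, so the largest eigenvalue is replaced by the
sum of the absolute values of the entries:
[x_i m x_j <= |m| (x_i^2 + x_j^2) / 2 <= |m| x^T x]. *)
Lemma qform_le {n} (M : 'M[F]_n) :
  exists c, forall x, qform M x <= c * qform 1%:M x.
Proof.
exists (\sum_i \sum_j `|M i j|) => x.
have sq_le k : x k 0 ^+ 2 <= qform 1%:M x.
  rewrite qform1E (bigD1 k) //= lerDl sumr_ge0 // => i _.
  exact: sqr_ge0.
rewrite qform_sumE mulr_suml; apply: ler_sum => i _.
rewrite mulr_suml; apply: ler_sum => j _.
have prod_le : `|x i 0 * x j 0| <= qform 1%:M x.
  have := sq_le i; have := sq_le j.
  have := sqr_ge0 (x i 0 - x j 0); have := sqr_ge0 (x i 0 + x j 0).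
  by rewrite ler_norml; move=> *; apply/andP; split; nra.
rewrite mulrAC mulrC; apply: le_trans (ler_norm _) _.
by rewrite normrM ler_wpM2l.
Qed.

(** * Finsler's lemma *)

(** The Gram matrix of [S] on a basis of the kernel has trivial kernel by
definiteness, and inverting it gives the [S]-orthogonal projection [P]. *)
Lemma kernel_projection {n q} {S : 'M[F]_n} {C : 'M[F]_(q, n)} :
  (forall x : 'cV_n, C *m x = 0 -> x != 0 -> qform S x < 0) ->
  exists P : 'M[F]_n,
    [/\ C *m P = 0, forall x : 'cV_n, C *m x = 0 -> P *m x = x
      & P^T *m S *m (1%:M - P) = 0].
Proof.
move=> Sneg; pose N := (row_base (kermx C^T))^T.
have CN : C *m N = 0.
  apply: trmx_inj; rewrite trmx_mul trmxK trmx0; apply/sub_kermxP.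
  by rewrite eq_row_base.
have kerN (x : 'cV_n) : C *m x = 0 -> exists y, x = N *m y.
  move=> Cx; have : (x^T <= row_base (kermx C^T))%MS.
    by rewrite eq_row_base; apply/sub_kermxP; rewrite -trmx_mul Cx trmx0.
  by case/submxP => D xD; exists D^T; rewrite -trmx_mul -xD trmxK.
pose G := N^T *m S *m N.
have Gunit : G \in unitmx.
  rewrite -unitmx_tr -row_free_unit -kermx_eq0; apply/rowV0P => u /sub_kermxP uG.
  have Gu : G *m u^T = 0 by rewrite -[LHS]trmxK trmx_mul trmxK uG trmx0.
  have Nu : N *m u^T = 0.
    apply/eqP; apply/negPn/negP => Nu0.
    have := Sneg _ _ Nu0; rewrite mulmxA CN mul0mx -qform_congr => /(_ erefl).
    by rewrite /qform -mulmxA Gu mulmx0 mxE ltxx.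
  apply: (row_free_inj (row_base_free (kermx C^T))).
  by rewrite mul0mx -[LHS]trmxK trmx_mul Nu trmx0.
exists (N *m invmx G *m N^T *m S); split.
- by rewrite !mulmxA CN !mul0mx.
- move=> x /kerN[y ->].
  have -> : N *m invmx G *m N^T *m S *m (N *m y) = N *m (invmx G *m G) *m y.
    by rewrite /G !mulmxA.
  by rewrite mulVmx // mulmx1.
- have NSP : N^T *m S *m (1%:M - N *m invmx G *m N^T *m S) = 0.
    rewrite mulmxBr mulmx1 !mulmxA -/G mulmxV // mul1mx.
    exact: subrr.
  rewrite !trmx_mul trmxK -!mulmxA [X in _ *m (_ *m (_ *m X))]mulmxA.
  by rewrite -!mulmxA in NSP *; rewrite NSP !mulmx0.
Qed.

(** Along the splitting [x = P x + (1 - P) x] of [kernel_projection], with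
[y = C x], the form is [S(P x) + S(L y) - t y^T y]; the map [L] exists because
[1 - P] kills the kernel of [C], which contains [x - pinvmx C *m C *m x]. *)
Lemma finsler {n q} {S : 'M[F]_n} {C : 'M[F]_(q, n)} :
  S^T = S -> (forall x : 'cV_n, C *m x = 0 -> x != 0 -> qform S x < 0) ->
  exists t, forall x : 'cV_n, x != 0 -> qform (S - t *: (C^T *m C)) x < 0.
Proof.
move=> sS Sneg; have [P [CP Pid PSQ]] := kernel_projection Sneg.
pose L := (1%:M - P) *m pinvmx C.
have remE (x : 'cV_n) : x - P *m x = L *m (C *m x).
  set d := pinvmx C *m (C *m x).
  have : P *m (x - d) = x - d.
    apply: Pid; rewrite mulmxBr [C *m d]mulmxA mulmxA.
    by rewrite mulmxKpV ?subrr.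
  rewrite /L -mulmxA -/d mulmxBl mul1mx mulmxBr => Pd.
  by rewrite -{1}(subrK d x) -Pd addrAC [_ - _ - P *m x]addrAC subrr add0r addrC.
have [c Lc] := qform_le (L^T *m S *m L).
(* The excess [1] over the bound gives strictness when the kernel part is 0. *)
exists (c + 1) => x x0.
have orth : (P *m x)^T *m S *m (x - P *m x) = 0.
  by rewrite trmx_mul -[X in X - _]mul1mx -mulmxBl -!mulmxA
     [X in _ *m X]mulmxA [X in _ *m X]mulmxA PSQ mul0mx mulmx0.
have Sx : qform S x = qform S (P *m x) + qform S (x - P *m x).
  by rewrite -(qform_orthoD sS orth) addrC subrK.
have CCx : qform (C^T *m C) x = qform 1%:M (C *m x).
  by rewrite -qform_congr mulmx1.
rewrite qformB qformZ Sx CCx remE.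
have y_ge0 := qform1_ge0 (C *m x); have := Lc (C *m x).
rewrite qform_congr => y_le.
have [Px0|Px0] := eqVneq (P *m x) 0.
  have y_gt0 : 0 < qform 1%:M (C *m x).
    rewrite lt0r y_ge0 qform1_eq0 andbT.
    by apply: contra_neq x0 => Cx0; rewrite -(Pid _ Cx0).
  rewrite Px0 qform0; lra.
have : qform S (P *m x) < 0 by apply: Sneg; rewrite // mulmxA CP mul0mx.
lra.
Qed.

End QuadraticForms.

(** * Fields of values of real matrices *)

Section FieldOfValues.
Context {R : realType}.

Lemma Re_sum {I : Type} (r : seq I) (f : I -> R[i]) :
  complex.Re (\sum_(i <- r) f i) = \sum_(i <- r) complex.Re (f i).
Proof. by apply: (big_morph (@complex.Re R)) => // [[? ?] [? ?]]. Qed.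

(** As [M] is real, the cross terms [a^T M b] and [b^T M a] of [x = a + i b] enter
with a factor [i] and only contribute to the imaginary part. *)
Lemma Re_complexify_form {n} (M : 'M[R]_n) (x : 'cV[R[i]]_n) :
  complex.Re ((map_mx Num.conj x^T *m complexify M *m x) 0 0) =
    qform M (map_mx (@complex.Re R) x) + qform M (map_mx (@complex.Im R) x).
Proof.
rewrite !qform_sumE -big_split mxE Re_sum /=.
under eq_bigr => j _ do rewrite mxE mulr_suml Re_sum.
rewrite exchange_big; apply: eq_bigr => i _ /=.
rewrite -big_split; apply: eq_bigr => j _ /=; rewrite !mxE.
case: (x i 0) => a b; case: (x j 0) => c d /=; ring.
Qed.

Lemma euclidean_norm_eq1 {n} (x : 'cV[R[i]]_n) :
  euclidean_norm x = 1 <->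
  qform 1%:M (map_mx (@complex.Re R) x) + qform 1%:M (map_mx (@complex.Im R) x)
    = 1.
Proof.
rewrite /euclidean_norm !qform1E -big_split /=.
have -> : \sum_i `|x i 0| ^+ 2 = real_complex R
    (\sum_i (map_mx (@complex.Re R) x i 0 ^+ 2 +
             map_mx (@complex.Im R) x i 0 ^+ 2)).
  rewrite rmorph_sum; apply: eq_bigr => i _.
  by rewrite -add_Re2_Im2 !mxE.
split=> [/(congr1 (fun z => z ^+ 2))|->]; last by rewrite rmorph1 sqrtC1.
by rewrite sqrtCK expr1n => /complexI.
Qed.

(** A real vector is the complex vector with zero imaginary part, and rescaling
it to unit length multiplies the form by a positive number; conversely the real
and imaginary parts of a unit vector do not both vanish. *)
Lemma field_of_values_left_half_planeP {n} (M : 'M[R]_n) :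
  field_of_values M `<=` open_left_half_plane R <->
  forall x : 'cV[R]_n, x != 0 -> qform M x < 0.
Proof.
split=> [Mleft x x0 | Mneg z [x x1 ->]].
  have N_gt0 : 0 < qform 1%:M x by rewrite lt0r qform1_eq0 x0 qform1_ge0.
  pose s := Num.sqrt (qform 1%:M x).
  have s_gt0 : 0 < s by rewrite sqrtr_gt0.
  pose u := complexify (s^-1 *: x).
  have uRe : map_mx (@complex.Re R) u = s^-1 *: x.
    by apply/matrixP => i j; rewrite !mxE.
  have uIm : map_mx (@complex.Im R) u = 0.
    by apply/matrixP => i j; rewrite !mxE.
  have u1 : euclidean_norm u = 1.
    apply/euclidean_norm_eq1; rewrite uRe uIm qform0 addr0 qform_scale.
    by rewrite exprVn sqr_sqrtr ?qform1_ge0 // mulVf // gt_eqF.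
  have := Mleft _ (ex_intro2 _ _ u u1 erefl).
  rewrite /open_left_half_plane /= Re_complexify_form uRe uIm qform0 addr0.
  by rewrite qform_scale pmulr_rlt0 // exprn_gt0 // invr_gt0.
rewrite /open_left_half_plane /= Re_complexify_form.
move/euclidean_norm_eq1: x1.
set a := map_mx _ x; set b := map_mx _ x.
have form_le0 y : qform M y <= 0.
  by have [->|/Mneg/ltW//] := eqVneq y 0; rewrite qform0.
have := form_le0 a; have := form_le0 b.
have [->|/Mneg] := eqVneq a 0; last lra.
have [->|/Mneg] := eqVneq b 0; last by rewrite qform0; lra.
by rewrite !qform0; lra.
Qed.

End FieldOfValues.

Theorem theorem3p2 (R : realType) (n q : nat)
    (hq : (0 < q)%N) (hqn : (q < n)%N)
    (A : 'M[R]_n) (B : 'M[R]_(n, q))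
    (hstable : spectrum A `<=` open_left_half_plane R)
    (hW : field_of_values A `&` open_right_half_plane R !=set0) :
  negative_definite_on_kernel (A + A^T) B^T <->
  exists K : 'M[R]_(q, n),
    field_of_values (A - B *m K) `<=` open_left_half_plane R.
Proof.
have qform_symE (M : 'M[R]_n) x : qform (M + M^T) x = 2 * qform M x.
  by rewrite qformD qform_tr; ring.
split=> [Sneg|[K /field_of_values_left_half_planeP Kneg] x Bx x0]; last first.
  rewrite -/(qform _ x) qform_symE pmulr_rlt0 //.
  have := Kneg x x0; rewrite qformB.
  suff -> : qform (B *m K) x = 0 by rewrite subr0.
  have xB : x^T *m B = 0 by apply: trmx_inj; rewrite trmx_mul trmxK Bx trmx0.
  by rewrite /qform mulmxA xB !mul0mx mxE.
have sS : (A + A^T)^T = A + A^T by rewrite linearD /= trmxK addrC.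
have [t tneg] := finsler sS Sneg.
exists ((t / 2) *: B^T); apply/field_of_values_left_half_planeP => x x0.
have := tneg x x0.
rewrite trmxK -scalemxAr !qformB !qformZ qform_symE; lra.
Qed.
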